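(* Let $X$ be a Banach space and let $Y$ be a closed subspace of $X$. Assume that $X$ has the Daugavet property and that $0\in X/Y$ satisfies $0\in\mathrm{SCD}(C)$ for every convex subset $C\subseteq B_{X/Y}$ containing $0$. Then $Y$ has the Daugavet property.
   Context: Banach spaces are over $\mathbb{K}=\mathbb{R}$ or $\mathbb{C}$; $B_X$ and $X^*$ denote the closed unit ball and the topological dual of $X$. A slice of a bounded set $A\subseteq X$ is a non-empty intersection of $A$ with an open half-space; it can be written as $S(A,x^*,\alpha)=\{x\in A:\operatorname{Re}x^*(x)>\sup_{b\in A}\operatorname{Re}x^*(b)-\alpha\}$ with $x^*\in X^*$, $\alpha>0$. Let $A\subseteq X$ be bounded and convex and $a\in A$. A countable collection $\{V_n:n\in\mathbb{N}\}$ of non-empty subsets of $A$ is determining for $a$ if $a\in\overline{\mathrm{conv}}(B)$ whenever $B\subseteq A$ intersects all the sets $V_n$. The point $a$ is an SCD point (slicely countably determined point) of $A$ if there is a sequence of slices of $A$ that is determining for $a$; $\mathrm{SCD}(A)$ is the set of all SCD points of $A$. A Banach space $X$ has the Daugavet property if $\|\mathrm{Id}+T\|=1+\|T\|$ for every rank-one bounded linear operator $T:X\to X$, where $\mathrm{Id}$ is the identity operator. $X/Y$ carries the quotient norm. *)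

(* Defs.v *)
From HB Require Import structures.
From mathcomp Require Import all_boot all_order all_algebra.
From mathcomp Require Import generic_quotient ring_quotient complex.
From mathcomp Require Import all_classical all_reals all_analysis.

Set Implicit Arguments.
Unset Strict Implicit.
Unset Printing Implicit Defensive.

Import Order.TTheory GRing.Theory Num.Theory.
Import numFieldNormedType.Exports.

Local Open Scope classical_set_scope.
Local Open Scope quotient_scope.
Local Open Scope ring_scope.

Inductive scalar_kind := RealScalars | ComplexScalars.

Section Scalars.
Variable R : realType.

Definition scalars (k : scalar_kind) : numFieldType :=
  match k with
  | RealScalars => R
  | ComplexScalars => R[i]
  end.

(* In MathComp-Analysis the norm of a normed module over K takes its values
   in K, so [re] also serves to read a norm as an element of R. *)
Definition re (k : scalar_kind) : scalars k -> R :=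
  match k return scalars k -> R with
  | RealScalars => fun x => x
  | ComplexScalars => fun z => complex.Re z
  end.

Definition of_real (k : scalar_kind) : R -> scalars k :=
  match k return R -> scalars k with
  | RealScalars => fun x => x
  | ComplexScalars => fun x => real_complex R x
  end.

Variable k : scalar_kind.
Implicit Types (a b : R) (x y : scalars k).

Lemma of_realK a : re (of_real k a) = a.
Proof. by case: k. Qed.

Lemma of_realD a b : of_real k (a + b) = of_real k a + of_real k b.
Proof. by case: k => //=; rewrite rmorphD. Qed.

Lemma of_realM a b : of_real k (a * b) = of_real k a * of_real k b.
Proof. by case: k => //=; rewrite rmorphM. Qed.

Lemma of_real0 : of_real k 0 = 0.
Proof. by case: k. Qed.

Lemma ler_of_real a b : (of_real k a <= of_real k b) = (a <= b).
Proof. by case: k => //=; rewrite lecR. Qed.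

Lemma ltr_of_real a b : (of_real k a < of_real k b) = (a < b).
Proof. by case: k => //=; rewrite ltcR. Qed.

Lemma of_real_re x : 0 <= x -> of_real k (re x) = x.
Proof. by case: k x => //= x x0; rewrite RRe_real // ger0_real. Qed.

End Scalars.
Arguments of_real {R k}.

Section NormedSpaces.
Variables (R : realType) (k : scalar_kind).
Local Notation K := (scalars R k).

Definition rnorm (X : normedModType K) (x : X) : R := re `|x|.

Section RealNormTheory.
Variable X : normedModType K.
Implicit Types x y : X.

Lemma rnormE x : of_real (rnorm x) = `|x|.
Proof. exact: of_real_re. Qed.

Lemma rnorm_ge0 x : 0 <= rnorm x.
Proof. by rewrite -(ler_of_real k) of_real0 rnormE. Qed.

Lemma ler_rnormD x y : rnorm (x + y) <= rnorm x + rnorm y.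
Proof. by rewrite -(ler_of_real k) of_realD !rnormE ler_normD. Qed.

Lemma rnormZ (l : K) x : rnorm (l *: x) = re `|l| * rnorm x.
Proof.
by rewrite -[LHS](of_realK k) -[RHS](of_realK k) of_realM !rnormE of_real_re // normrZ.
Qed.

End RealNormTheory.

Definition unit_ball (X : normedModType K) : set X := [set x | `|x| <= 1].
Arguments unit_ball X : clear implicits.

Definition opnorm (X Z : normedModType K) (T : X -> Z) : R :=
  sup [set rnorm (T x) | x in unit_ball X].

(* The range is a line, hence nonzero: the zero operator is not of rank one. *)
Definition rank_one (X Z : normedModType K) (T : X -> Z) : Prop :=
  exists2 z : Z, z != 0 & range T = [set a *: z | a in [set: K]].

Definition daugavet_property (X : normedModType K) : Prop :=
  forall T : {linear X -> X}, continuous T -> rank_one T ->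
    opnorm (idfun \+ T) = 1 + opnorm T.

(* Over K = R[i], the elements of `[0, 1] for the partial order of R[i] are real,
   so that [convex_set] is the usual (real) convexity for both scalar fields. *)
Definition convex_hull (X : normedModType K) (B : set X) : set X :=
  \bigcap_(C in [set C : set X | @convex_set K X C /\ B `<=` C]) C.

Definition slice (X : normedModType K) (A : set X) (f : X -> K) (alpha : R) :
    set X :=
  [set x | A x /\ sup [set re (f b) | b in A] - alpha < re (f x)].

Definition is_slice (X : normedModType K) (A S : set X) : Prop :=
  S !=set0 /\
  exists (f : {linear X -> K^o}) (alpha : R),
    [/\ continuous f, 0 < alpha & S = slice A f alpha].

Definition determining (X : normedModType K) (A : set X) (a : X)
    (V : nat -> set X) : Prop :=
  (forall n, V n !=set0 /\ V n `<=` A) /\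
  forall B : set X, B `<=` A -> (forall n, (B `&` V n) !=set0) ->
    closure (convex_hull B) a.

(* Used for bounded convex [A] only; boundedness of [A] makes the [sup] in
   [slice] a genuine supremum. *)
Definition SCD (X : normedModType K) (A : set X) : set X :=
  [set a | A a /\
    exists V : nat -> set X, (forall n, is_slice A (V n)) /\ determining A a V].

End NormedSpaces.
Arguments unit_ball {R k} X.

Section Subspace.
Variables (R : realType) (k : scalar_kind).
Local Notation K := (scalars R k).
Variables (X : normedModType K) (Y : submodClosed X).

Definition subspace_of : Type := {x : X | x \in Y}.

HB.instance Definition _ := SubType.on subspace_of.
HB.instance Definition _ := [Choice of subspace_of by <:].
HB.instance Definition _ := [SubChoice_isSubLmodule of subspace_of by <:].

Let subnorm (y : subspace_of) : K := `|\val y|.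

Let ler_subnormD y1 y2 : subnorm (y1 + y2) <= subnorm y1 + subnorm y2.
Proof. exact: ler_normD. Qed.

Let subnormZ (l : K) y : subnorm (l *: y) = `|l| * subnorm y.
Proof. exact: normrZ. Qed.

Let subnorm0_eq0 y : subnorm y = 0 -> y = 0.
Proof. by move=> /normr0_eq0 y0; apply: val_inj. Qed.

HB.instance Definition _ := Lmodule_isNormed.Build K subspace_of
  ler_subnormD subnormZ subnorm0_eq0.

Lemma subspace_normE (y : subspace_of) : `|y| = `|\val y|.
Proof. by []. Qed.

End Subspace.

Section QuotientSpace.
Variables (R : realType) (k : scalar_kind).
Local Notation K := (scalars R k).
Variables (X : normedModType K) (Y : submodClosed X).

(* [Y] as an additive subgroup, which is what [Quotient.quot] expects. *)
Definition subspace_pred : {pred X} := fun x => x \in Y.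

Let subspace_pred_zmod_closed : zmod_closed subspace_pred.
Proof.
split=> [|x y xY yY]; first exact: (rpred0 Y).
by apply: (rpredD (S := Y)) => //; rewrite -scaleN1r; apply: (rpredZ (s := Y)).
Qed.

HB.instance Definition _ :=
  GRing.isZmodClosed.Build X subspace_pred subspace_pred_zmod_closed.

(* The closedness of [Y] is a parameter of the type because without it the
   quotient norm is only a seminorm. *)
Definition quotient_of of closed [set x | x \in Y] : Type :=
  Quotient.quot subspace_pred.

Variable clY : closed [set x | x \in Y].
Local Notation Q := (quotient_of clY).

HB.instance Definition _ := GRing.Zmodule.on Q.
HB.instance Definition _ := EqQuotient.on Q.

Definition quotient_map (x : X) : Q := \pi_(Quotient.quot subspace_pred) x.

Lemma quotient_mapP x y : quotient_map x = quotient_map y <-> x - y \in Y.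
Proof.
rewrite -[x - y \in Y]/(x - y \in subspace_pred) Quotient.idealrBE.
by split=> [/eqP|/eqP].
Qed.

Let reprQ (q : Q) : X := repr (q : Quotient.quot subspace_pred).

Let reprQK q : quotient_map (reprQ q) = q.
Proof. exact: reprK. Qed.

Lemma quotient_mapD x y : quotient_map (x + y) = quotient_map x + quotient_map y.
Proof. exact: Quotient.pi_add. Qed.

Let scaleq (l : K) (q : Q) : Q := quotient_map (l *: reprQ q).

Let scaleq_map l x : scaleq l (quotient_map x) = quotient_map (l *: x).
Proof.
apply/quotient_mapP; rewrite -scalerBr; apply: rpredZ.
by apply/quotient_mapP; rewrite reprQK.
Qed.

Let scaleqA a b q : scaleq a (scaleq b q) = scaleq (a * b) q.
Proof. by rewrite -[q]reprQK !scaleq_map scalerA. Qed.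

Let scale1q : left_id 1 scaleq.
Proof. by move=> q; rewrite -[q]reprQK scaleq_map scale1r. Qed.

Let scaleqDr : right_distributive scaleq +%R.
Proof.
move=> a p q.
by rewrite -[p]reprQK -[q]reprQK -quotient_mapD !scaleq_map scalerDr quotient_mapD.
Qed.

Let scaleqDl q : {morph scaleq^~ q : a b / a + b}.
Proof.
by move=> a b /=; rewrite -[q]reprQK !scaleq_map scalerDl quotient_mapD.
Qed.

HB.instance Definition _ :=
  GRing.Zmodule_isLmodule.Build K Q scaleqA scale1q scaleqDr scaleqDl.

Lemma quotient_mapZ l x : quotient_map (l *: x) = l *: quotient_map x.
Proof. by rewrite -scaleq_map. Qed.

Definition coset_norms (q : Q) : set R :=
  [set rnorm x | x in [set x | quotient_map x = q]].

Definition quotient_norm (q : Q) : K := of_real (inf (coset_norms q)).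

Let coset_norms_has_inf q : has_inf (coset_norms q).
Proof.
split; first by exists (rnorm (reprQ q)), (reprQ q).
by exists 0 => _ [x _ <-]; exact: rnorm_ge0.
Qed.

Let inf_coset_le x : inf (coset_norms (quotient_map x)) <= rnorm x.
Proof. by apply: ge_inf; [case: (coset_norms_has_inf (quotient_map x))|exists x]. Qed.

Let inf_coset_lt q (e : R) : 0 < e ->
  exists2 x, quotient_map x = q & rnorm x < inf (coset_norms q) + e.
Proof.
move=> e0; have [_ [x xq <-] xe] := inf_adherent e0 (coset_norms_has_inf q).
by exists x.
Qed.

Let ler_quotient_normD p q :
  quotient_norm (p + q) <= quotient_norm p + quotient_norm q.
Proof.
rewrite /quotient_norm -of_realD ler_of_real; apply/ler_addgt0Pr => e e0.
have e20 : 0 < e / 2 by rewrite divr_gt0.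
have [x xp xe] := inf_coset_lt p e20; have [y yq ye] := inf_coset_lt q e20.
rewrite -xp -yq -quotient_mapD xp yq; apply: (le_trans (inf_coset_le _)).
apply: (le_trans (ler_rnormD _ _)).
by rewrite (splitr e) addrACA lerD // ltW.
Qed.

Let inf_cosetZ_le (l : K) q :
  inf (coset_norms (l *: q)) <= re `|l| * inf (coset_norms q).
Proof.
have l0 : 0 <= re `|l| by exact: (@rnorm_ge0 _ _ K^o l).
apply/ler_addgt0Pr => e e0.
have l1 : 0 < re `|l| + 1 by rewrite ltr_wpDl.
have d0 : 0 < e / (re `|l| + 1) by rewrite divr_gt0.
have [x xq xe] := inf_coset_lt q d0.
rewrite -{1}xq -quotient_mapZ; apply: (le_trans (inf_coset_le _)).
rewrite rnormZ; apply: (le_trans (ler_wpM2l l0 (ltW xe))).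
rewrite mulrDr lerD2l mulrCA ger_pMr // ler_pdivrMr // mul1r lerDl.
exact: ler01.
Qed.

Let quotient_normZ (l : K) q : quotient_norm (l *: q) = `|l| * quotient_norm q.
Proof.
rewrite /quotient_norm -[`|l|]of_real_re // -of_realM; congr of_real.
apply/eqP; rewrite eq_le inf_cosetZ_le /=.
have [->|l0] := eqVneq l 0.
  rewrite normr0 -(of_real0 R k) of_realK mul0r.
  by apply: lb_le_inf => [|_ [x _ <-]]; [case: (coset_norms_has_inf (of_real 0 *: q))
    |exact: rnorm_ge0].
have rl0 : 0 < re `|l|.
  rewrite lt_def (@rnorm_ge0 _ _ K^o l) andbT; apply: contra l0 => /eqP l0.
  by rewrite -normr_eq0 -[`|l|]of_real_re // l0 of_real0.
rewrite -ler_pdivlMl //; have := inf_cosetZ_le l^-1 (l *: q).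
rewrite scalerA mulVf // scale1r => /le_trans; apply.
suff -> : re `|l^-1| = (re `|l|)^-1 by [].
apply: (mulfI (lt0r_neq0 rl0)); rewrite divff ?lt0r_neq0 //.
rewrite -[LHS](of_realK k) of_realM !of_real_re // -normrM divff // normr1.
by case: (k).
Qed.

Let quotient_norm0_eq0 q : quotient_norm q = 0 -> q = 0.
Proof.
rewrite /quotient_norm -(of_real0 R k) => /(congr1 (@re R k)).
rewrite !of_realK => q0.
have -> : (0 : Q) = quotient_map 0 by rewrite -(scale0r (0 : X)) quotient_mapZ scale0r.
rewrite -[q]reprQK; apply/quotient_mapP; rewrite subr0.
apply: clY => A /nbhs_ballP[e /= e0 eA].
have re0 : 0 < re e by rewrite -(ltr_of_real k) of_real0 of_real_re // ltW.
have [x xq] := inf_coset_lt q re0; rewrite q0 add0r => xe.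
exists (reprQ q - x); split; first by apply/quotient_mapP; rewrite reprQK.
apply: eA; rewrite -ball_normE /= opprB addrC subrK -rnormE.
by rewrite -[e]of_real_re ?ltW // ltr_of_real.
Qed.

HB.instance Definition _ := Lmodule_isNormed.Build K Q
  ler_quotient_normD quotient_normZ quotient_norm0_eq0.

Lemma quotient_normE (q : Q) : `|q| = of_real (inf (coset_norms q)).
Proof. by []. Qed.

End QuotientSpace.

(* Main.v *)
Require Import Defs.
From HB Require Import structures.
From mathcomp Require Import all_boot all_order all_algebra.
From mathcomp Require Import complex.
From mathcomp Require Import all_classical all_reals all_analysis.
From mathcomp Require Import ring lra.

Set Implicit Arguments.
Unset Strict Implicit.
Unset Printing Implicit Defensive.

Import Order.TTheory GRing.Theory Num.Theory.
Import numFieldNormedType.Exports.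

Local Open Scope classical_set_scope.
Local Open Scope ring_scope.

(** Let [q] be the quotient map, [f] a functional of norm at most [1] on the
    subspace, [s] a nonzero vector of the subspace, and suppose that
    [re (f y0) > c] for some [y0] in its unit ball.  By [daugavet_of_slices] it
    is enough to find [y] in the unit ball of the subspace with [re (f y)]
    almost [c] and [|s + y|] almost [|s| + 1].

    Extend [f] to a functional [F] on the whole space ([hahn_banach_subspace])
    and let [S] be the slice [F > c] of the unit ball of the whole space.  The
    image [q S] is convex and contains [0 = q y0], so some sequence of slices
    [V n] of [q S] is determining for [0].  Suppose that [E] is a convex subset
    of the unit ball such that [|s + z|] is almost [|s| + 1] for every [z] in
    [E], and that [E] meets every [S `&` q @^-1` (V n)].  Then [q (E `&` S)]
    meets every [V n] and is convex, so it contains vectors of arbitrarily small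
    norm: some [z] in [E `&` S] is as close as desired to the subspace, and a
    nearby normalised vector of the subspace is the required [y]
    ([subspace_slice]).

    It remains to construct [E].  The Daugavet property says that every slice of
    the ball contains [x] with [|v + x|] almost [|v| + 1], for every nonzero [v]
    ([daugavet_slice]).  Hence, given countably many slices of the ball, points
    [x n] can be picked one in each so that [|s + x 0 + ... + x n|] is almost
    [|s| + n + 1]; by the triangle inequality [|s + z|] is then almost [|s| + 1]
    for every convex combination [z] of the [x n] ([far_convex_set]).  The
    sets [S `&` q @^-1` (V n)] are intersections of two slices of the ball rather
    than slices.  A planar separation argument shows, however, that a convex set
    meets such an intersection as soon as it meets countably many slices, given
    by the rational convex combinations of the two functionals
    ([convex_meets_quadrant]). *)

(** * Linear functionals below a sublinear one *)

Section Sublinear.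
Variables (R : realType) (V : lmodType R).
Implicit Types (p q : V -> R) (x y : V) (a : R).

Definition sublinear p : Prop :=
  (forall x y, p (x + y) <= p x + p y) /\
  (forall a x, 0 < a -> p (a *: x) = a * p x).

Lemma sublinear0 p : sublinear p -> p 0 = 0.
Proof.
by move=> [_ pZ]; have := pZ 2 0 (ltr0n _ 2); rewrite scaler0; lra.
Qed.

Lemma sublinear_opp_le p x : sublinear p -> - p (- x) <= p x.
Proof.
by move=> sp; have := sp.1 x (- x); rewrite subrr sublinear0 //; lra.
Qed.

(** A scaled inequality in one direction gives the equality, by undoing the
    scaling. *)
Lemma sublinearP p :
  (forall x y, p (x + y) <= p x + p y) ->
  (forall a x, 0 < a -> p (a *: x) <= a * p x) -> sublinear p.
Proof.
move=> pD pZ; split=> // a x a0; apply/eqP; rewrite eq_le pZ //=.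
rewrite -ler_pdivlMl //; have := pZ a^-1 (a *: x).
by rewrite scalerA mulVf ?gt_eqF // scale1r invr_gt0 => /(_ a0).
Qed.

(** Subadditivity passes to the infimum of a chain because two members of the
    chain that nearly realise the infimum at [x] and at [y] can be replaced by
    the smaller one. *)
Lemma sublinear_chain_inf (A : set (V -> R)) : A !=set0 ->
  (forall q, A q -> sublinear q) ->
  (forall q r, A q -> A r -> (forall x, q x <= r x) \/ (forall x, r x <= q x)) ->
  exists2 m, sublinear m & forall q, A q -> forall x, m x <= q x.
Proof.
move=> [q0 Aq0] slA chA; pose m x := inf [set q x | q in A].
have hi x : has_inf [set q x | q in A].
  split; first by exists (q0 x), q0.
  exists (- q0 (- x)) => _ [q Aq <-].
  have sq := slA _ Aq; have sq0 := slA _ Aq0.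
  have [h|h] := chA _ _ Aq Aq0.
    by have := sublinear_opp_le x sq; have := h (- x); lra.
  by have := sublinear_opp_le x sq0; have := h x; lra.
have mle q x : A q -> m x <= q x.
  by move=> Aq; apply: ge_inf; [case: (hi x)|exists q].
have mlt x e : 0 < e -> exists2 q, A q & q x < m x + e.
  by move=> e0; have [_ [q Aq <-] qe] := inf_adherent e0 (hi x); exists q.
exists m => [|q Aq x]; last exact: mle.
apply: sublinearP => [x y|a x a0]; apply/ler_addgt0Pr => e e0.
  have e2 : 0 < e / 2 by lra.
  have [q Aq qx] := mlt x _ e2; have [r Ar ry] := mlt y _ e2.
  have [h|h] := chA _ _ Aq Ar.
    by have := mle _ (x + y) Aq; have := (slA _ Aq).1 x y; have := h y; lra.
  by have := mle _ (x + y) Ar; have := (slA _ Ar).1 x y; have := h x; lra.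
have [q Aq qx] := mlt x (e / a) (divr_gt0 e0 a0).
apply: (le_trans (mle _ _ Aq)); rewrite (slA _ Aq).2 //.
by move: qx; rewrite -(ltr_pM2l a0) mulrDr [in ltRHS]mulrCA divff ?gt_eqF// mulr1 => /ltW.
Qed.

(** The functional [x |-> inf_(t > 0) (q (x + t y) - t q y)] is sublinear and
    below [q]; minimality of [q] makes it equal to [q], and [t = 1] then gives
    [q x + q y <= q (x + y)]. *)
Lemma minimal_sublinear_additive q : sublinear q ->
  (forall r, sublinear r -> (forall x, r x <= q x) -> r = q) ->
  forall x y, q (x + y) = q x + q y.
Proof.
move=> sq qmin x y.
have [qD qZ] := sq.
pose A z := [set q (z + t *: y) - t * q y | t in [set t | 0 < t]].
have hi z : has_inf (A z).
  split; first by exists (q (z + 1 *: y) - 1 * q y), 1 => //=; lra.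
  exists (- q (- z)) => _ [t t0 <-].
  by have := qD (z + t *: y) (- z); rewrite addrAC subrr add0r qZ //; lra.
have ile z t : 0 < t -> inf (A z) <= q (z + t *: y) - t * q y.
  by move=> t0; apply: ge_inf; [case: (hi z)|exists t].
have ilt z e : 0 < e -> exists2 t, 0 < t & q (z + t *: y) - t * q y < inf (A z) + e.
  by move=> e0; have [_ [t t0 <-] te] := inf_adherent e0 (hi z); exists t.
have sr : sublinear (fun z => inf (A z)).
  apply: sublinearP => [z w|a z a0]; apply/ler_addgt0Pr => e e0.
    have e2 : 0 < e / 2 by lra.
    have [t t0 tz] := ilt z _ e2; have [u u0 uw] := ilt w _ e2.
    apply: (le_trans (ile _ (t + u) _)); first lra.
    by rewrite scalerDl addrACA; have := qD (z + t *: y) (w + u *: y); lra.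
  have [t t0 tz] := ilt z (e / a) (divr_gt0 e0 a0).
  apply: (le_trans (ile _ (a * t) (mulr_gt0 a0 t0))).
  rewrite -scalerA -scalerDr qZ // -mulrA -mulrBr.
  by move: tz; rewrite -(ltr_pM2l a0) [ltRHS]mulrDr mulrCA divff ?gt_eqF// mulr1 => /ltW.
have rq z : inf (A z) <= q z.
  apply/ler_addgt0Pr => e e0; apply: (le_trans (ile z 1 _)); first lra.
  by rewrite scale1r mul1r; have := qD z y; lra.
have rE := congr1 (fun h => h x) (qmin _ sr rq); rewrite /= in rE.
apply/eqP; rewrite eq_le qD /=.
by have := ile x 1 ltr01; rewrite rE scale1r mul1r; lra.
Qed.

Lemma additive_sublinear_linear q : sublinear q ->
  (forall x y, q (x + y) = q x + q y) ->
  exists u : {linear V -> R^o}, forall x, u x = q x.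
Proof.
move=> sq qD; have q0 := sublinear0 sq.
have qN x : q (- x) = - q x by have := qD x (- x); rewrite subrr q0; lra.
have qZ a x : q (a *: x) = a * q x.
  have [a0|a0|->] := ltrgt0P a; last by rewrite scale0r mul0r.
    exact: sq.2.
  by have := sq.2 (- a) x; rewrite oppr_gt0 scaleNr qN mulNr => /(_ a0)/oppr_inj.
have lq : linear (q : V -> R^o) by move=> a x y; rewrite qD qZ.
pose u : {linear V -> R^o} :=
  HB.pack (q : V -> R^o) (GRing.isLinear.Build _ _ _ _ (q : V -> R^o) lq).
by exists u.
Qed.

(** Hahn-Banach: a minimal sublinear functional below [p], given by Zorn's
    lemma, is linear. *)
Theorem sublinear_minorant p : sublinear p ->
  exists u : {linear V -> R^o}, forall x, u x <= p x.
Proof.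
move=> sp.
pose T := {q : V -> R | sublinear q /\ forall x, q x <= p x}.
pose below (q r : T) : bool := `[< forall x, sval r x <= sval q x >].
have [||[q r] [s t] /asboolP qs /asboolP sq||] := @Zorn T below.
- by move=> q; apply/asboolP.
- move=> q r s /asboolP qr /asboolP rs; apply/asboolP => x.
  exact: le_trans (rs x) (qr x).
- by apply: eq_exist => /=; apply/funext => x; apply/eqP; rewrite eq_le qs sq.
- move=> A Atot; have [[q0 Aq0]|A0] := pselect (A !=set0); last first.
    by exists (exist _ p (conj sp (fun=> lexx _))) => q Aq; case: A0; exists q.
  have [|_ [q _ <-]|_ _ [q Aq <-] [r Ar <-]|m sm mle] :=
      @sublinear_chain_inf [set sval q | q in A].
  + by exists (sval q0), q0.
  + by case: (svalP q).
  + by case: (Atot _ _ Aq Ar) => /asboolP h; [right|left].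
  have mp x : m x <= p x.
    apply: le_trans (mle (sval q0) _ x) ((svalP q0).2 x).
    by exists q0.
  by exists (exist _ m (conj sm mp)) => q Aq; apply/asboolP => x /=; apply: mle; exists q.
move=> [q [sq qp]] qmin.
have [r sr rq|u uq] := additive_sublinear_linear sq (minimal_sublinear_additive sq _).
  have rp x : r x <= p x := le_trans (rq x) (qp x).
  have /qmin/(congr1 sval) // : below (exist _ q (conj sq qp)) (exist _ r (conj sr rp)).
  exact/asboolP.
by exists u => x; rewrite uq.
Qed.

End Sublinear.

(** * Real and complex scalars *)

Section ScalarTheory.
Variables (R : realType) (k : scalar_kind).
Local Notation K := (scalars R k).
Implicit Types (x y : K) (a : R).

Lemma reD x y : re (x + y) = re x + re y.
Proof. by case: k x y => //= -[a b] [c d]. Qed.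

Lemma reN x : re (- x) = - re x.
Proof. by case: k x => //= -[a b]. Qed.

Lemma reB x y : re (x - y) = re x - re y.
Proof. by rewrite reD reN. Qed.

Lemma re_of_realM a x : re (of_real a * x) = a * re x.
Proof. by case: k x => //= -[b c] /=; rewrite mul0r subr0. Qed.

Lemma of_real1 : of_real 1 = 1 :> K.
Proof. by case: k. Qed.

Lemma of_realN a : of_real (- a) = - of_real a :> K.
Proof. by case: k => //=; rewrite rmorphN. Qed.

Lemma of_real_norm a : 0 <= a -> `|of_real a : K| = of_real a.
Proof. by move=> a0; rewrite ger0_norm // -(of_real0 R k) ler_of_real. Qed.

Lemma of_real_real a : (of_real a : K) \is Num.real.
Proof. by rewrite realE -(of_real0 R k) !ler_of_real; case: ltgtP. Qed.

Lemma re_norm_ge0 x : 0 <= re `|x|.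
Proof. exact: (@rnorm_ge0 _ _ K^o x). Qed.

Lemma re_norm_complex (a b : R) :
  re `|Complex a b : scalars R ComplexScalars| = Num.sqrt (a ^+ 2 + b ^+ 2).
Proof. by have /(congr1 (@complex.Re R)) := normc_def (Complex a b). Qed.

Lemma re_le_norm x : re x <= re `|x|.
Proof.
case: k x => [x|[a b]]; first exact: ler_norm.
rewrite re_norm_complex; apply: le_trans (ler_norm a) _.
by rewrite -sqrtr_sqr ler_wsqrtr // lerDl sqr_ge0.
Qed.

Lemma unimodular_rotation x : exists2 t : K, `|t| = 1 & t * x = `|x|.
Proof.
have [->|x0] := eqVneq x 0; first by exists 1; rewrite ?normr1 // mulr0 normr0.
exists (`|x| / x); last by rewrite divfK.
by rewrite normrM normfV normr_id divff // normr_eq0.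
Qed.

(** This is [|x - 1| ^+ 2 = |x| ^+ 2 + 1 - 2 * re x]. *)
Lemma norm_sub1_le x a : re `|x| <= 1 -> 0 <= a -> 1 - a ^+ 2 / 2 <= re x ->
  re `|x - 1| <= a.
Proof.
case: k x => [x|[b c]].
  rewrite -[re `|x|]/`|x : R| -[re `|x - 1|]/`|x - 1 : R| -[re x]/x.
  by rewrite !ler_norml => /andP[x1 x2] a0 xa; apply/andP; split; nra.
have -> : (Complex b c : scalars R ComplexScalars) - 1 = Complex (b - 1) (c - 0) by [].
rewrite !re_norm_complex subr0 -[re _]/b => h a0 bx.
have bc : b ^+ 2 + c ^+ 2 <= 1.
  rewrite -(sqr_sqrtr (addr_ge0 (sqr_ge0 b) (sqr_ge0 c))).
  by rewrite expr_le1 ?sqrtr_ge0.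
by rewrite -[leRHS]ger0_norm // -sqrtr_sqr ler_wsqrtr //; nra.
Qed.

End ScalarTheory.

Section NormTheory.
Variables (R : realType) (k : scalar_kind).
Local Notation K := (scalars R k).

Section Norm.
Variable X : normedModType K.
Implicit Types x y : X.

Lemma unit_ballP x : unit_ball X x <-> rnorm x <= 1.
Proof. by rewrite /unit_ball /= -rnormE -(of_real1 R k) ler_of_real. Qed.

Lemma rnormN x : rnorm (- x) = rnorm x.
Proof. by rewrite /rnorm normrN. Qed.

Lemma rnorm0 : rnorm (0 : X) = 0.
Proof. by rewrite /rnorm normr0 -(of_real0 R k) of_realK. Qed.

Lemma rnormBC x y : rnorm (x - y) = rnorm (y - x).
Proof. by rewrite /rnorm distrC. Qed.

Lemma rnorm_gt0 x : x != 0 -> 0 < rnorm x.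
Proof.
by rewrite -normr_gt0 -(ltr_of_real k) of_real0 rnormE.
Qed.

Lemma rnormZ_real a x : 0 <= a -> rnorm (of_real a *: x) = a * rnorm x.
Proof. by move=> a0; rewrite rnormZ of_real_norm // of_realK. Qed.

Lemma rnormZ_unimodular (t : K) x : `|t| = 1 -> rnorm (t *: x) = rnorm x.
Proof. by move=> t1; rewrite rnormZ t1 -of_real1 of_realK mul1r. Qed.

End Norm.

Lemma convex_setP (X : lmodType K) (A : set X) : convex_set A <->
  forall x y (a b : R), 0 <= a -> 0 <= b -> a + b = 1 -> A x -> A y ->
  A (of_real a *: x + of_real b *: y).
Proof.
split=> [cA x y a b a0 b0 ab Ax Ay|cA].
  have a0' : 0 <= of_real a :> K by rewrite -(of_real0 R k) ler_of_real.
  have a1' : of_real a <= 1 :> K by rewrite -(of_real1 R k) ler_of_real; lra.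
  have := cA x y (Itv01 a0' a1'); rewrite !inE => /(_ Ax Ay).
  suff -> : of_real b = 1 - of_real a :> K by [].
  by rewrite -(of_real1 R k) -of_realN -of_realD; congr of_real; lra.
move=> x y l; rewrite !inE => Ax Ay.
have l0 : 0 <= l%:num by [].
have l1 : l%:num <= 1 by [].
have := cA x y (re l%:num) (1 - re l%:num).
rewrite of_realD of_real1 of_realN of_real_re //; apply=> //.
- by rewrite -(ler_of_real k) of_real0 of_real_re.
- by rewrite -(ler_of_real k) of_real0 of_realD of_realN of_real1 of_real_re // subr_ge0.
- by lra.
Qed.

Lemma continuous_linear_rnorm (X Z : normedModType K) (T : {linear X -> Z}) :
  continuous T -> exists2 M, 0 < M & forall x, rnorm (T x) <= M * rnorm x.
Proof.
move=> /linear_bounded_continuous/linear_boundedP/pinfty_ex_gt0[M M0 TM].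
have MR : of_real (re M) = M by rewrite of_real_re // ltW.
exists (re M); first by rewrite -(ltr_of_real k) of_real0 MR.
by move=> x; rewrite -(ler_of_real k) of_realM MR !rnormE.
Qed.

Lemma rnorm_linear_continuous (X Z : normedModType K) (T : {linear X -> Z}) M :
  (forall x, rnorm (T x) <= M * rnorm x) -> continuous T.
Proof.
move=> TM; apply/linear_bounded_continuous/linear_boundedP.
near=> r => x; rewrite -!rnormE.
apply: (@le_trans _ _ (of_real M * `|x|)).
  by rewrite -rnormE -of_realM ler_of_real.
rewrite -rnormE ler_wpM2r ?rnormE //; near: r; apply: nbhs_pinfty_ge.
exact: of_real_real.
Unshelve. all: by end_near. Qed.

End NormTheory.

(** * Extension of functionals from a subspace *)

(** The space seen over the reals, where the Hahn-Banach theorem takes place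
    before a functional over the original scalars is recovered. *)
Definition realified (R : realType) (k : scalar_kind)
  (X : lmodType (scalars R k)) : Type := X.

Section Realified.
Variables (R : realType) (k : scalar_kind).
Local Notation K := (scalars R k).
Variable X : lmodType K.

HB.instance Definition _ := GRing.Zmodule.on (realified X).

Let rscale (a : R) (x : realified X) : realified X := of_real a *: (x : X).

Let rscaleA a b x : rscale a (rscale b x) = rscale (a * b) x.
Proof. by rewrite /rscale scalerA of_realM. Qed.

Let rscale1 : left_id 1 rscale.
Proof. by move=> x; rewrite /rscale of_real1 scale1r. Qed.

Let rscaleDr : right_distributive rscale +%R.
Proof. by move=> a x y; rewrite /rscale scalerDr. Qed.

Let rscaleDl x : {morph rscale^~ x : a b / a + b}.
Proof. by move=> a b; rewrite /rscale of_realD scalerDl. Qed.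

HB.instance Definition _ := GRing.Zmodule_isLmodule.Build R (realified X)
  rscaleA rscale1 rscaleDr rscaleDl.

End Realified.

(** Over the complex numbers the functional is [x |-> u x - i u (i x)]. *)
Lemma linear_of_real_part (R : realType) (k : scalar_kind)
    (X : lmodType (scalars R k)) (u : {linear realified X -> R^o}) :
  exists F : {linear X -> (scalars R k)^o}, forall x, re (F x) = u x.
Proof.
case: k X u => X u.
  have lu : linear (u : X -> R^o) by exact: linearP u.
  pose F : {linear X -> (scalars R RealScalars)^o} :=
    HB.pack (u : X -> R^o) (GRing.isLinear.Build _ _ _ _ (u : X -> R^o) lu).
  by exists F.
pose i : scalars R ComplexScalars := Complex 0 1.
pose f (x : X) : (scalars R ComplexScalars)^o := Complex (u x) (- u (i *: x)).
have uD (x y : X) : u (x + y) = u x + u y by exact: raddfD u x y.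
have uZ (a : R) (x : X) : u ((of_real a : scalars R ComplexScalars) *: x) = a * u x.
  exact: linearZ_LR u a x.
have lf : linear f.
  move=> [a b] x y; rewrite /f.
  have -> : Complex a b = of_real a + of_real b * i :> scalars R ComplexScalars.
    by apply/eqP; rewrite eq_complex /= !(mul0r, mulr0, mulr1, addr0, add0r, subr0) !eqxx.
  have ii : i * i = of_real (-1) :> scalars R ComplexScalars.
    by apply/eqP; rewrite eq_complex /= !(mul0r, mulr0, mulr1, addr0, add0r, subr0) !eqxx.
  rewrite scalerDr scalerA mulrDr (mulrC i) mulrCA ii -of_realM !scalerDl.
  rewrite -!scalerA !uD !uZ.
  apply/eqP; rewrite eq_complex /=; apply/andP; split; apply/eqP; ring.
pose F : {linear X -> (scalars R ComplexScalars)^o} :=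
  HB.pack f (GRing.isLinear.Build _ _ _ _ f lf).
by exists F.
Qed.

Section HahnBanach.
Variables (R : realType) (k : scalar_kind).
Local Notation K := (scalars R k).
Variables (X : normedModType K) (Y : submodClosed X).

(** The extension is a linear functional below the inf-convolution
    [x |-> inf_y (re (f y) + |x - y|)], which is sublinear, below the norm, and
    below the real part of [f] on the subspace. *)
Theorem hahn_banach_subspace (f : {linear subspace_of Y -> K^o}) :
  (forall y, re `|f y| <= rnorm y) ->
  exists2 F : {linear X -> K^o},
    (forall x, re `|F x| <= rnorm x) & forall y, F (val y) = f y.
Proof.
move=> fle.
have vD (y z : subspace_of Y) : val (y + z) = val y + val z by [].
have vZ (a : K) (y : subspace_of Y) : val (a *: y) = a *: val y by [].
pose A x := [set re (f y) + rnorm (x - val y) | y in [set: subspace_of Y]].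
have hi x : has_inf (A x).
  split; first by exists (re (f 0) + rnorm (x - val (0 : subspace_of Y))), 0.
  exists (- rnorm x) => _ [y _ <-].
  have := re_le_norm (f (- y)); rewrite raddfN reN normrN => fy.
  have yle : rnorm y <= rnorm (x - val y) + rnorm x.
    rewrite rnormBC -[leLHS]/(rnorm (val y)) -{1}(subrK x (val y)).
    exact: ler_rnormD.
  by have := fle y; lra.
have ile x y : inf (A x) <= re (f y) + rnorm (x - val y).
  by apply: ge_inf; [case: (hi x)|exists y].
have ilt x e : 0 < e -> exists y, re (f y) + rnorm (x - val y) < inf (A x) + e.
  by move=> e0; have [_ [y _ <-] ye] := inf_adherent e0 (hi x); exists y.
have sp : sublinear (fun x : realified X => inf (A x)).
  apply: sublinearP => [x y|a x a0]; apply/ler_addgt0Pr => e e0.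
    have e2 : 0 < e / 2 by lra.
    have [y1 h1] := ilt x _ e2; have [y2 h2] := ilt y _ e2.
    have := ile (x + y) (y1 + y2); rewrite raddfD reD vD opprD addrACA.
    by have := ler_rnormD (x - val y1) (y - val y2); lra.
  have [y h] := ilt x (e / a) (divr_gt0 e0 a0).
  have := ile (of_real a *: (x : X)) (of_real a *: y).
  rewrite vZ linearZ /= re_of_realM -scalerBr rnormZ_real ?(ltW a0) // -mulrDr.
  move=> /le_trans; apply; move: h; rewrite -(ltr_pM2l a0) [ltRHS]mulrDr.
  by rewrite mulrCA divff ?gt_eqF // mulr1 => /ltW.
have [u up] := sublinear_minorant sp.
have [F Fu] := linear_of_real_part u.
have Fre x : re (F x) <= rnorm x.
  rewrite Fu; apply: le_trans (up x) _; have := ile x 0.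
  by rewrite raddf0 -(of_real0 R k) of_realK add0r subr0.
have Fle y : re (F (val y)) <= re (f y).
  rewrite Fu; apply: le_trans (up _) _; have := ile (val y) y.
  by rewrite subrr rnorm0 addr0.
have Ff y : re (F (val y)) = re (f y).
  apply/eqP; rewrite eq_le Fle; have := Fle (- y).
  by rewrite !raddfN !reN lerN2.
exists F => [x|y].
  have [t t1 tF] := unimodular_rotation (F x).
  by rewrite -tF -[t * _]/(t *: F x) -linearZ -(rnormZ_unimodular x t1).
apply/eqP; rewrite -subr_eq0; apply/eqP/normr0_eq0.
have [t t1 tw] := unimodular_rotation (F (val y) - f y).
rewrite -[LHS]of_real_re // -tw mulrBr reB.
have := Ff (t *: y); rewrite vZ !linearZ /= -!/(t * _) => ->.
by rewrite subrr of_real0.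
Qed.

End HahnBanach.

(** * The Daugavet property through slices *)

Section Opnorm.
Variables (R : realType) (k : scalar_kind).
Local Notation K := (scalars R k).
Variables (X Z : normedModType K) (f : X -> Z) (M : R).
Hypothesis fM : forall x, unit_ball X x -> rnorm (f x) <= M.

Lemma unit_ball0 : unit_ball X 0.
Proof. by apply/unit_ballP; rewrite rnorm0 ler01. Qed.

Lemma opnorm_has_sup : has_sup [set rnorm (f x) | x in unit_ball X].
Proof.
split; first by exists (rnorm (f 0)), 0 => //; exact: unit_ball0.
by exists M => _ [x x1 <-]; exact: fM.
Qed.

Lemma le_opnorm x : unit_ball X x -> rnorm (f x) <= opnorm f.
Proof. by move=> x1; apply: ub_le_sup; [case: opnorm_has_sup|exists x]. Qed.

Lemma opnorm_le : opnorm f <= M.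
Proof.
by apply: ge_sup; [case: opnorm_has_sup|move=> _ [x x1 <-]; exact: fM].
Qed.

Lemma opnorm_approx e : 0 < e ->
  exists2 x, unit_ball X x & opnorm f - e < rnorm (f x).
Proof.
move=> e0; have [_ [x x1 <-] xe] := sup_adherent e0 opnorm_has_sup.
by exists x.
Qed.

End Opnorm.

Section Daugavet.
Variables (R : realType) (k : scalar_kind).
Local Notation K := (scalars R k).
Variable X : normedModType K.
Implicit Types (x s : X) (F : {linear X -> K^o}).

Lemma continuous_linear_ball (Z : normedModType K) (T : {linear X -> Z}) :
  continuous T -> exists M, forall x, unit_ball X x -> rnorm (T x) <= M.
Proof.
move=> /continuous_linear_rnorm[M M0 TM]; exists M => x /unit_ballP x1.
by apply: le_trans (TM x) _; rewrite ger_pMr.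
Qed.

Lemma le_opnorm_linear (Z : normedModType K) (T : {linear X -> Z}) x :
  continuous T -> rnorm (T x) <= opnorm T * rnorm x.
Proof.
move=> /continuous_linear_ball[M TM].
have [->|x0] := eqVneq x 0; first by rewrite raddf0 !rnorm0 mulr0.
have nx := rnorm_gt0 x0.
rewrite -ler_pdivrMr // mulrC -rnormZ_real ?invr_ge0 ?(ltW nx) // -linearZ_LR.
apply: (le_opnorm TM); apply/unit_ballP.
by rewrite rnormZ_real ?invr_ge0 ?(ltW nx) // mulVf // gt_eqF.
Qed.

Lemma rank_one_functional F s : (exists x, F x != 0) -> s != 0 ->
  rank_one (fun x => F x *: s).
Proof.
move=> [x Fx] s0; exists s => //; apply/seteqP; split=> _ [a _ <-].
  by exists (F a).
exists ((a / F x) *: x) => //=; congr (_ *: _).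
by rewrite linearZ_LR; exact: divfK.
Qed.

(** Applied to [F] normalised to have norm 1 and to the direction [s], the
    Daugavet equation gives [x] in the ball with [|x + F x s|] close to
    [1 + |s|]. After a rotation of [x] making [F x] nonnegative, the triangle
    inequality forces [F x] to be close to [1]. *)
Lemma daugavet_slice F s x0 (c e : R) : daugavet_property X ->
  continuous F -> (exists x, F x != 0) -> s != 0 ->
  unit_ball X x0 -> c < re (F x0) -> 0 < e ->
  exists x, [/\ unit_ball X x, c < re (F x) & rnorm s + 1 - e < rnorm (s + x)].
Proof.
move=> DX cF [w Fw] s0 x01 cx0 e0.
have [B FB] := continuous_linear_ball cF.
pose M := opnorm F.
have M0 : 0 < M.
  have Mw : 0 < M * rnorm w := lt_le_trans (rnorm_gt0 Fw) (le_opnorm_linear w cF).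
  rewrite ltNge; apply/negP => M0.
  by have := mulr_le0_ge0 M0 (rnorm_ge0 w); rewrite leNgt Mw.
have Mn0 : M != 0 by rewrite gt_eqF.
have ns := rnorm_gt0 s0.
have cM : c < M.
  by apply: (lt_le_trans cx0); apply: le_trans (re_le_norm _) (le_opnorm FB x01).
pose z := of_real M^-1 *: s.
have z0 : z != 0.
  rewrite scaler_eq0 negb_or s0 andbT -(of_real0 R k) (inj_eq (can_inj (@of_realK R k))).
  by rewrite invr_eq0.
have lT : linear (fun x => F x *: z).
  by move=> a x y; rewrite linearP scalerDl; congr (_ + _); exact/esym/scalerA.
pose T : {linear X -> X} :=
  HB.pack (fun x => F x *: z) (GRing.isLinear.Build _ _ _ _ (fun x => F x *: z) lT).
have TE x : T x = of_real M^-1 *: (F x *: s) by rewrite /T /= /z !scalerA mulrC.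
have TF x : rnorm (T x) = M^-1 * re `|F x| * rnorm s.
  by rewrite TE rnormZ_real ?invr_ge0 ?(ltW M0) // rnormZ mulrA.
have cT : continuous T.
  apply: (@rnorm_linear_continuous _ _ _ _ T (rnorm s)) => x.
  rewrite TF mulrC ler_wpM2l ?rnorm_ge0 // mulrC ler_pdivrMr // mulrC.
  exact: le_opnorm_linear x cF.
have := DX T cT (rank_one_functional (ex_intro _ w Fw) z0).
have [BT hT] := continuous_linear_ball cT.
have nT : rnorm s <= opnorm T.
  rewrite -(ler_pM2l M0) -ler_pdivlMr // {1}/M; apply: opnorm_le => x x1.
  rewrite ler_pdivlMr //; have := le_opnorm hT x1; rewrite TF.
  by rewrite -(ler_pM2l M0) !mulrA divff // mul1r.
have hS x : unit_ball X x -> rnorm ((idfun \+ T) x) <= 1 + BT.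
  move=> x1; apply: le_trans (ler_rnormD _ _) _; apply: lerD (hT _ x1).
  exact/unit_ballP.
(* A loss of [h] in the norm equation may be charged twice to the norm of the
   sum, and once, divided by [rnorm s / M], to the value of [F]. *)
pose h := Num.min (e / 2) ((M - c) * rnorm s / M).
have h0 : 0 < h by rewrite lt_min divr_gt0 //= divr_gt0 // mulr_gt0 // subr_gt0.
have [x x1] := opnorm_approx hS h0 => + DT; rewrite DT => xh.
have [t t1 tF] := unimodular_rotation (F x).
pose m := re `|F x|.
have Ftx : F (t *: x) = of_real m by rewrite linearZ_LR of_real_re.
have m0 : 0 <= m by exact: re_norm_ge0.
have mM : m <= M by rewrite /m; apply: (le_opnorm FB x1).
have tx1 : rnorm (t *: x) <= 1 by rewrite rnormZ_unimodular //; exact/unit_ballP.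
pose r := m / M.
have rM : r * M = m by rewrite divfK.
have r1 : r <= 1 by rewrite ler_pdivrMr // mul1r.
have r0 : 0 <= r by rewrite divr_ge0 // ltW.
have big : 1 + rnorm s - h < rnorm (t *: x + of_real r *: s).
  have -> : t *: x + of_real r *: s = t *: (x + T x).
    by rewrite scalerDr -linearZ TE Ftx scalerA -of_realM mulrC.
  by rewrite rnormZ_unimodular //; apply: le_lt_trans xh; lra.
have rs : rnorm s - h < r * rnorm s.
  by have := ler_rnormD (t *: x) (of_real r *: s); rewrite (rnormZ_real _ r0); lra.
exists (t *: x); split; first exact/unit_ballP.
- rewrite Ftx of_realK; have : h <= (M - c) * rnorm s / M by rewrite ge_min lexx orbT.
  rewrite ler_pdivlMr // => hM.
  have : (rnorm s - h) * M < m * rnorm s by rewrite -rM mulrAC ltr_pM2r.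
  by move=> ?; rewrite -(ltr_pM2r ns); nra.
have he : h <= e / 2 by rewrite ge_min lexx.
have -> : s + t *: x = (t *: x + of_real r *: s) + of_real (1 - r) *: s.
  by rewrite -addrA -scalerDl -of_realD addrC subrKC of_real1 scale1r.
have := ler_rnormD (t *: x + of_real r *: s + of_real (1 - r) *: s)
  (- (of_real (1 - r) *: s)).
by rewrite addrK rnormN rnormZ_real ?subr_ge0 //; nra.
Qed.

End Daugavet.

(** * Convex sets far from the opposite of a vector *)

Section FarSets.
Variables (R : realType) (k : scalar_kind).
Local Notation K := (scalars R k).
Variable X : normedModType K.
Implicit Types (x s v z : X) (D E : set X).

Definition daugavet_set D : Prop := D `<=` unit_ball X /\
  forall v (e : R), v != 0 -> 0 < e ->
    exists2 x, D x & rnorm v + 1 - e < rnorm (v + x).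

Lemma convex_unit_ball : convex_set (unit_ball X).
Proof.
apply/convex_setP => x y a b a0 b0 ab /unit_ballP x1 /unit_ballP y1.
apply/unit_ballP; apply: le_trans (ler_rnormD _ _) _.
by rewrite !rnormZ_real //; nra.
Qed.

(** Points [x n] of [P n] are chosen one after the other so that the norm of
    [s + x 0 + ... + x n] stays within [e] of its largest possible value.  The
    set [E] consists of the [z] in the ball whose removal from
    [x 0 + ... + x (n - 1)] leaves a vector of norm at most [n - 1] for all
    large [n].  It is visibly convex, it contains each [x m], since what remains
    is a sum of [n - 1] vectors of the ball, and the triangle inequality bounds
    [s + z] from below. *)
Lemma far_convex_set (P : nat -> set X) s (e : R) :
  (forall n, daugavet_set (P n)) -> s != 0 -> 0 < e ->
  exists E, [/\ convex_set E, E `<=` unit_ball X,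
    forall n, (E `&` P n) !=set0 &
    forall z, E z -> rnorm s + 1 - e <= rnorm (s + z)].
Proof.
move=> DP s0 e0; have ns := rnorm_gt0 s0.
(* The bound [d <= rnorm s] keeps all the partial sums nonzero, so that the next
   point can be chosen. *)
pose d := Num.min e (rnorm s).
have d0 : 0 < d by rewrite lt_min e0.
have de : d <= e by rewrite ge_min lexx.
have ds : d <= rnorm s by rewrite ge_min lexx orbT.
pose err n : R := d * 2^-1 ^+ n.
have err0 n : 0 < err n by rewrite mulr_gt0 // exprn_gt0.
have errS n : err n.+1 = err n / 2 by rewrite /err exprSr mulrA.
have step (nv : nat * X) : exists x, nv.2 != 0 ->
    P nv.1 x /\ rnorm nv.2 + 1 - err nv.1 / 2 < rnorm (nv.2 + x).
  have [->|v0] := eqVneq nv.2 0; first by exists 0.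
  have [x Px vx] := (DP nv.1).2 _ _ v0 (divr_gt0 (err0 nv.1) (ltr0n _ 2)).
  by exists x.
have [f fP] := choice step.
pose fix V n := if n is m.+1 then V m + f (m, V m) else s.
pose x n := f (n, V n).
have VS n : V n.+1 = V n + x n by [].
have Vn n : rnorm s + n%:R - d + err n <= rnorm (V n).
  elim: n => [|n IH]; first by rewrite /err expr0 mulr1 subrK addr0.
  have Vn0 : V n != 0.
    apply: contraTneq IH => ->; rewrite rnorm0 -ltNge.
    by have := err0 n; have := ler0n R n; lra.
  have h : rnorm (V n) + 1 - err n / 2 < rnorm (V n.+1) := (fP (n, V n) Vn0).2.
  by rewrite errS -natr1; lra.
have xP n : P n (x n).
  apply: (fP (n, V n) _).1 => /=.
  apply: contraTneq (Vn n) => ->; rewrite rnorm0 -ltNge.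
  by have := err0 n; have := ler0n R n; lra.
have x1 n : rnorm (x n) <= 1 by apply/unit_ballP/(DP n).1.
have Vs n : rnorm (V n - s) <= n%:R.
  elim: n => [|n IH]; first by rewrite subrr rnorm0.
  rewrite VS addrAC -natr1; apply: le_trans (ler_rnormD _ _) _.
  exact: lerD.
pose E := [set z | unit_ball X z /\
  exists N, forall n, (N <= n)%N -> rnorm (V n - s - z) <= n%:R - 1].
exists E; split.
- apply/convex_setP => y z a b a0 b0 ab [y1 [N yN]] [z1 [L zL]]; split.
    by apply: (convex_setP _).1 convex_unit_ball _ _ _ _ _ _ _ _ _.
  exists (maxn N L) => n; rewrite geq_max => /andP[Nn Ln].
  have -> : V n - s - (of_real a *: y + of_real b *: z) =
      of_real a *: (V n - s - y) + of_real b *: (V n - s - z).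
    rewrite !(scalerBr _ _ y) !(scalerBr _ _ z) addrACA -scalerDl -of_realD ab.
    by rewrite of_real1 scale1r opprD.
  apply: le_trans (ler_rnormD _ _) _; rewrite !rnormZ_real //.
  by have := yN _ Nn; have := zL _ Ln; nra.
- by move=> z [].
- move=> m; exists (x m); split => //; split; first exact/unit_ballP.
  exists m.+1; elim=> // n IH; rewrite ltnS leq_eqVlt => /predU1P[<-|mn].
    by rewrite VS -natr1 addrK addrAC addrK; exact: Vs.
  rewrite VS -natr1 -addrA addrAC; apply: le_trans (ler_rnormD _ _) _.
  by have := IH mn; have := x1 n; rewrite addrA; lra.
- move=> z [_ [N zN]].
  have VE : V N = V N - s - z + (s + z) by rewrite -(addrA (V N)) -opprD subrK.
  have := ler_rnormD (V N - s - z) (s + z); rewrite -VE.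
  by have := zN _ (leqnn N); have := Vn N; have := err0 N; lra.
Qed.

(** Write [p] for [re F - c] and [q] for [re G - d], and [l] for the weight
    attached to [i] in the grid.  Pick the first [i] for which the chosen point
    has [p > 0], and the point chosen for [i - 1]: if neither lies in the
    quadrant they lie on either side of it, and the segment joining them passes
    on the positive side of the origin, as both have [l p + (1 - l) q > 0] once
    the grid is fine enough. *)
Lemma convex_meets_quadrant E (F G : {linear X -> K^o}) (c d B e : R) :
  convex_set E -> 0 < e ->
  (forall x, E x -> `|re (F x) - c| <= B /\ `|re (G x) - d| <= B) ->
  (forall (N : nat) (i : 'I_N.+2), let l := i%:R / N.+1%:R in
    exists2 x, E x & e < l * (re (F x) - c) + (1 - l) * (re (G x) - d)) ->
  exists x, [/\ E x, c < re (F x) & d < re (G x)].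
Proof.
move=> cE e0 EB H.
pose p x := re (F x) - c; pose q x := re (G x) - d.
suff [x [Ex px qx]] : exists x, [/\ E x, 0 < p x & 0 < q x].
  by exists x; split; rewrite // -subr_gt0.
have affine (L : {linear X -> K^o}) m x y (a b : R) : a + b = 1 ->
    re (L (of_real a *: x + of_real b *: y)) - m =
    a * (re (L x) - m) + b * (re (L y) - m).
  move=> ab; rewrite linearD !linearZ_LR reD.
  by rewrite !(re_of_realM _ (L _)) -[m in LHS]mul1r -ab; ring.
have [N hN] : exists N : nat, 2 * B / e < N.+1%:R.
  exists (Num.truncn (`|2 * B / e|)); apply: le_lt_trans (ler_norm _) _.
  by have /andP[_] := truncn_itv (normr_ge0 (2 * B / e)).
have N0 : 0 < N.+1%:R :> R by rewrite ltr0n.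
rewrite ltr_pdivrMr // in hN.
pose l i : R := i%:R / N.+1%:R.
have H' i : (i <= N.+1)%N ->
    exists2 x, E x & e < l i * p x + (1 - l i) * q x.
  by rewrite -ltnS => iN; exact: (H N (Ordinal iN)).
pose good i := (i <= N.+1)%N /\
  exists2 x, E x & e < l i * p x + (1 - l i) * q x /\ 0 < p x.
have [i [[iN [x Ex [xl px]]] imin]] :
    exists i, good i /\ forall j, (j < i)%N -> ~ good j.
  have gN : `[< good N.+1 >].
    apply/asboolP; split => //; have [x Ex xl] := H' _ (leqnn N.+1).
    exists x => //; split=> //; move: xl; rewrite /l divff ?gt_eqF //; lra.
  have [i /asboolP gi imin] := ex_minnP (ex_intro (fun i => `[< good i >]) _ gN).
  exists i; split=> // j ji gj.
  by have := imin j (asboolT gj); rewrite leqNgt ji.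
have [qx|qx] := ltP 0 (q x); first by exists x.
have li1 : l i <= 1 by rewrite ler_pdivrMr // mul1r ler_nat.
have i0 : (0 < i)%N.
  rewrite lt0n; apply: contraTneq xl => ->.
  by rewrite /l mul0r mul0r subr0 mul1r add0r -leNgt (le_trans qx) // ltW.
have [y Ey yl] := H' i.-1 (leq_trans (leq_pred i) iN).
have py : p y <= 0.
  rewrite leNgt; apply/negP => py; apply: (imin i.-1); first by rewrite prednK.
  by split; [exact: leq_trans (leq_pred i) iN|exists y].
pose r : R := N.+1%:R^-1.
have li : l i = l i.-1 + r.
  by rewrite /l -{1}(prednK i0) -natr1 mulrDl mul1r.
have li0 : 0 <= l i.-1 by rewrite divr_ge0 // ltW.
have r0 : 0 < r by rewrite invr_gt0.
have small : r * (2 * B) < e by rewrite /r mulrC ltr_pdivrMr // [ltRHS]mulrC.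
clearbody r l.
have li1' : 0 <= 1 - l i.-1 by lra.
have qy : 0 < q y.
  rewrite ltNge; apply/negP => qy.
  by have := mulr_ge0_le0 li0 py; have := mulr_ge0_le0 li1' qy; lra.
have yl' : 0 < l i * p y + (1 - l i) * q y.
  have [/ler_normlP[pB _] /ler_normlP[_ qB]] := EB _ Ey.
  rewrite -/(p y) -/(q y) in pB qB.
  have : r * (q y - p y) <= r * (2 * B) by rewrite ler_wpM2l ?(ltW r0) //; lra.
  by rewrite li; nra.
(* Multiply the two inequalities saying that [x] and [y] have positive weighted
   sums; the weights cancel. *)
have key : 0 < p x * q y - q x * p y.
  have [l1|l1] := eqVneq (l i) 1; first by nra.
  have ll : 0 < l i by lra.
  have ll1 : 0 < 1 - l i by rewrite subr_gt0 lt_neqAle l1.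
  have h1 : (1 - l i) * - q x < l i * p x by lra.
  have h2 : l i * - p y < (1 - l i) * q y by lra.
  have := ltr_pM (mulr_ge0 (ltW ll1) (_ : 0 <= - q x))
    (mulr_ge0 (ltW ll) (_ : 0 <= - p y)) h1 h2.
  rewrite !oppr_ge0 => /(_ qx py) h3.
  by rewrite -(pmulr_rgt0 _ (mulr_gt0 ll ll1)); lra.
pose t := p x - q x - p y + q y.
have t0 : 0 < t by rewrite /t; lra.
pose a := (q y - p y) / t; pose b := (p x - q x) / t.
have a0 : 0 <= a by rewrite divr_ge0 // ?(ltW t0) //; lra.
have b0 : 0 <= b by rewrite divr_ge0 // ?(ltW t0) //; lra.
have ab : a + b = 1.
  by rewrite -mulrDl -(divff (lt0r_neq0 t0)); congr (_ / _); rewrite /t; ring.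
exists (of_real a *: x + of_real b *: y); split.
- exact: (convex_setP E).1 cE _ _ _ _ a0 b0 ab Ex Ey.
- rewrite /p affine // -/(p x) -/(p y).
  have -> : a * p x + b * p y = (p x * q y - q x * p y) / t by rewrite /a /b; ring.
  exact: divr_gt0.
- rewrite /q affine // -/(q x) -/(q y).
  have -> : a * q x + b * q y = (p x * q y - q x * p y) / t by rewrite /a /b; ring.
  exact: divr_gt0.
Qed.

End FarSets.

(** * The quotient map *)

Section QuotientNorm.
Variables (R : realType) (k : scalar_kind).
Variables (X : normedModType (scalars R k)) (Y : submodClosed X).
Variable clY : closed [set x : X | x \in Y].
Local Notation Q := (quotient_of clY).

Lemma coset_norms_has_inf (q : Q) : has_inf (coset_norms q).
Proof.
split; last by exists 0 => _ [x _ <-]; exact: rnorm_ge0.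
by exists (rnorm (repr q)), (repr q) => //; exact: reprK.
Qed.

Lemma rnorm_quotientE (q : Q) : rnorm q = inf (coset_norms q).
Proof. by rewrite /rnorm quotient_normE of_realK. Qed.

Lemma rnorm_quotient_map x : rnorm (quotient_map clY x) <= rnorm x.
Proof.
rewrite rnorm_quotientE; apply: ge_inf; last by exists x.
by case: (coset_norms_has_inf (quotient_map clY x)).
Qed.

Lemma quotient_map_lift (q : Q) (e : R) : rnorm q < e ->
  exists2 x, quotient_map clY x = q & rnorm x < e.
Proof.
move=> qe; have e0 : 0 < e - rnorm q by rewrite subr_gt0.
have [_ [x xq <-] xe] := inf_adherent e0 (coset_norms_has_inf q).
by exists x => //; move: xe; rewrite -rnorm_quotientE; lra.
Qed.

Lemma linear_comp_quotient_map (f : {linear Q -> (scalars R k)^o}) :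
  exists G : {linear X -> (scalars R k)^o}, forall x, G x = f (quotient_map clY x).
Proof.
pose g x : (scalars R k)^o := f (quotient_map clY x).
have lg : linear g by move=> a x y; rewrite /g quotient_mapD quotient_mapZ linearP.
by exists (HB.pack g (GRing.isLinear.Build _ _ _ _ g lg) :
  {linear X -> (scalars R k)^o}).
Qed.

End QuotientNorm.

(** * Far convex sets meeting intersections of two slices *)

Section FarConvexSets.
Variables (R : realType) (k : scalar_kind).
Local Notation K := (scalars R k).
Variable X : normedModType K.
Hypothesis DX : daugavet_property X.
Variable F : {linear X -> K^o}.
Hypotheses (cF : continuous F) (F0 : exists x, F x != 0).

(** When the functional vanishes the slice is the whole ball, which contains
    the slices of any other functional. *)
Lemma slice_daugavet_set (L : {linear X -> K^o}) (c : R) : continuous L ->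
  (exists2 x, unit_ball X x & c < re (L x)) ->
  daugavet_set [set x | unit_ball X x /\ c < re (L x)].
Proof.
move=> cL [x0 x01 cx0]; split=> [x []//|v e v0 e0].
have [L0|L0] := pselect (exists x, L x != 0).
  by have [x [x1 cx vx]] := daugavet_slice DX cL L0 v0 x01 cx0 e0; exists x.
have LE x : L x = 0 by apply/eqP/negP => Lx; apply: L0; exists x; exact/negP.
have F1 : -1 < re (F 0) by rewrite raddf0 -(of_real0 R k) of_realK; lra.
have [x [x1 _ vx]] := daugavet_slice DX cF F0 v0 (unit_ball0 X) F1 e0.
by exists x => //; split=> //; rewrite LE -(LE x0).
Qed.

(** The countable family consists of the slices of the ball by the combinations
    [l F + (1 - l) G n] with [l] rational; meeting them all forces a convex set
    to meet each intersection of two slices. *)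
Lemma far_convex_set_two_slices (G : nat -> {linear X -> K^o}) (c : R)
    (d : nat -> R) s (e : R) :
  (forall n, continuous (G n)) ->
  (forall n, exists x, [/\ unit_ball X x, c < re (F x) & d n < re (G n x)]) ->
  s != 0 -> 0 < e ->
  exists E, [/\ convex_set E, E `<=` unit_ball X,
    forall n, exists x, [/\ E x, c < re (F x) & d n < re (G n x)] &
    forall z, E z -> rnorm s + 1 - e <= rnorm (s + z)].
Proof.
move=> cG /choice[w wP] s0 e0.
(* The margin [h n], half of what [w n] has to spare, makes the separation
   uniform in the weight, which a finite grid of weights requires. *)
pose h n := Num.min (re (F (w n)) - c) (re (G n (w n)) - d n) / 2.
have h0 n : 0 < h n.
  by case: (wP n) => _ h1 h2; rewrite divr_gt0 // lt_min !subr_gt0 h1.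
pose I := (nat * {N : nat & 'I_N.+2})%type.
pose l (i : I) : R := (tagged i.2)%:R / (tag i.2).+1%:R.
have l0 i : 0 <= l i by rewrite divr_ge0.
have l1 i : 0 <= 1 - l i.
  by rewrite subr_ge0 ler_pdivrMr ?ltr0n // mul1r ler_nat -ltnS ltn_ord.
pose L (i : I) : {linear X -> K^o} :=
  (of_real (l i) \*: F) \+ (of_real (1 - l i) \*: G i.1).
have LE i x : re (L i x) = l i * re (F x) + (1 - l i) * re (G i.1 x).
  by rewrite /L /= reD !(re_of_realM _ (_ x)).
have cL i : continuous (L i).
  have [A _ FA] := continuous_linear_rnorm cF.
  have [B _ GB] := continuous_linear_rnorm (cG i.1).
  apply: (@rnorm_linear_continuous _ _ _ _ (L i) (l i * A + (1 - l i) * B)) => x.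
  apply: le_trans (ler_rnormD _ _) _; rewrite !(rnormZ_real (_ x)) //.
  apply: le_trans (lerD (ler_wpM2l (l0 i) (FA x)) (ler_wpM2l (l1 i) (GB x))) _.
  by rewrite mulrA (mulrA (1 - l i)) -mulrDl.
pose c' i := l i * c + (1 - l i) * d i.1 + h i.1.
pose P i := [set x | unit_ball X x /\ c' i < re (L i x)].
have DP i : daugavet_set (P i).
  apply: slice_daugavet_set (cL i) _; exists (w i.1); first by case: (wP i.1).
  case: (wP i.1) => _ h1 h2; rewrite LE /c'.
  have hF : 2 * h i.1 <= re (F (w i.1)) - c.
    by rewrite mulrC divfK ?pnatr_eq0 // ge_min lexx.
  have hG : 2 * h i.1 <= re (G i.1 (w i.1)) - d i.1.
    by rewrite mulrC divfK ?pnatr_eq0 // ge_min lexx orbT.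
  have := ler_wpM2l (l0 i) hF; have := ler_wpM2l (l1 i) hG; have := h0 i.1.
  by rewrite !mulrBr; nra.
pose i0 : I := (0%N, Tagged (fun N => 'I_N.+2) (ord0 : 'I_2)).
have [E [cE E1 EP Ee]] := far_convex_set
  (fun m => DP (odflt i0 (unpickle m))) s0 e0.
exists E; split=> // n.
have [A FA] := continuous_linear_ball cF.
have [B GB] := continuous_linear_ball (cG n).
have absle a b M : re `|a : K| <= M -> `|re a - b| <= M + `|b|.
  move=> aM; apply: le_trans (ler_normB _ _) _; rewrite lerD2r ler_norml.
  have := re_le_norm a; have := re_le_norm (- a); rewrite reN normrN.
  by move=> ? ?; apply/andP; split; lra.
apply: (@convex_meets_quadrant _ _ _ E F (G n) c (d n)
  (Num.max (A + `|c|) (B + `|d n|)) (h n)) => // [x Ex|N i].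
  split; rewrite le_max.
    by rewrite absle // FA //; exact: E1.
  by rewrite [X in _ || X]absle ?orbT // GB //; exact: E1.
pose j : I := (n, Tagged (fun N => 'I_N.+2) i).
have [x [Ex]] := EP (pickle j); rewrite pickleK => -[_ hx].
exists x => //; have {}hx : c' j < re (L j x) by [].
rewrite -[_ / _]/(l j); move: hx; rewrite LE /c' -[j.1]/n.
by move: (l j) => a; lra.
Qed.

End FarConvexSets.

(** * The slices of the subspace *)

Section SubspaceSlices.
Variables (R : realType) (k : scalar_kind).
Local Notation K := (scalars R k).
Variables (X : normedModType K) (Y : submodClosed X).
Variable clY : closed [set x : X | x \in Y].
Hypothesis DX : daugavet_property X.
Hypothesis SCD0 : forall C : set (quotient_of clY),
  convex_set C -> C `<=` unit_ball (quotient_of clY) -> C 0 -> SCD C 0.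

(** The set [C] to which the hypothesis is applied is the image of the slice of
    the ball of the whole space cut out by an extension of [f]. *)
Lemma subspace_slice (f : {linear subspace_of Y -> K^o}) (y0 s : subspace_of Y)
    (c e : R) :
  (forall y, re `|f y| <= rnorm y) -> s != 0 -> 0 < c ->
  unit_ball _ y0 -> c < re (f y0) -> 0 < e ->
  exists y, [/\ unit_ball _ y, c - e < re (f y) & rnorm s + 1 - e < rnorm (s + y)].
Proof.
move=> fle s0 c0 y01 cy0 e0.
have [F Fle Ff] := hahn_banach_subspace fle.
have cF : continuous F.
  by apply: (@rnorm_linear_continuous _ _ _ _ F 1) => x; rewrite mul1r; exact: Fle.
have F0 : exists x, F x != 0.
  exists (val y0); apply: contraTneq cy0; rewrite Ff => ->.
  by rewrite -(of_real0 R k) of_realK -leNgt ltW.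
pose q := quotient_map clY.
pose S := [set x | unit_ball X x /\ c < re (F x)].
have cS : convex_set S.
  apply/convex_setP => x y a b a_ge b_ge ab [x1 cx] [y1 cy]; split.
    exact: (convex_setP _).1 (@convex_unit_ball _ _ X) _ _ _ _ a_ge b_ge ab x1 y1.
  rewrite linearD !linearZ_LR reD !(re_of_realM _ (F _)).
  apply: (@lt_le_trans _ _ (Num.min (re (F x)) (re (F y)))); first by rewrite lt_min cx.
  rewrite -[leLHS]mul1r -ab mulrDl.
  by apply: lerD; apply: ler_wpM2l => //; rewrite ge_min lexx ?orbT.
have convex_image (A : set X) : convex_set A -> convex_set (q @` A).
  move=> cA; apply/convex_setP => _ _ a b a_ge b_ge ab [x Ax <-] [y Ay <-].
  exists (of_real a *: x + of_real b *: y).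
    exact: (convex_setP _).1 cA _ _ _ _ a_ge b_ge ab Ax Ay.
  by rewrite /q quotient_mapD !quotient_mapZ.
have q0 y : q (val (y : subspace_of Y)) = 0.
  have -> : 0 = q 0 by rewrite /q -(scale0r (0 : X)) quotient_mapZ scale0r.
  by apply/quotient_mapP; rewrite subr0; exact: valP.
have [||_ [V [slV [VC detV]]]] := SCD0 (convex_image _ cS).
- move=> _ [x [x1 _] <-]; apply/unit_ballP.
  by apply: le_trans (rnorm_quotient_map _ _) _; exact/unit_ballP.
- by exists (val y0); [split; [exact: y01|rewrite Ff]|exact: q0].
have /choice[g gP] n : exists g : {linear X -> K^o} * R, [/\ continuous g.1,
    (exists x, S x /\ g.2 < re (g.1 x)) &
    forall x, S x -> g.2 < re (g.1 x) -> V n (q x)].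
  have [Vn0 [u [alpha [cu alpha0 VE]]]] := slV n.
  have [G GE] := linear_comp_quotient_map u.
  exists (G, sup [set re (u b) | b in q @` S] - alpha); split=> /=.
  - have [B B0 uB] := continuous_linear_rnorm cu.
    apply: (@rnorm_linear_continuous _ _ _ _ G B) => x; rewrite GE.
    by apply: le_trans (uB _) _; rewrite ler_wpM2l ?(ltW B0) // rnorm_quotient_map.
  - move: Vn0; rewrite VE => -[_ [[x Sx <-] xV]].
    by exists x; rewrite GE.
  - by move=> x Sx xV; rewrite VE; split; [exists x|rewrite -GE].
pose v : X := val s.
have v0 : v != 0 by apply: contra s0 => /eqP v0; apply/eqP/val_inj.
pose d := Num.min (e / 8) 1.
have d0 : 0 < d by rewrite lt_min ltr01 andbT divr_gt0.
have de : d <= e / 8 by rewrite ge_min lexx.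
have cG n : continuous (g n).1 by case: (gP n).
have gx n : exists x, [/\ unit_ball X x, c < re (F x) & (g n).2 < re ((g n).1 x)].
  by case: (gP n) => _ [x [[x1 cx] xg]] _; exists x.
have e2 : 0 < e / 2 by rewrite divr_gt0.
have [E [cE E1 EV Ee]] := far_convex_set_two_slices DX cF F0 cG gx v0 e2.
have cES : convex_set (E `&` S).
  apply/convex_setP => x y a b a_ge b_ge ab [Ex Sx] [Ey Sy].
  by split; [apply: (convex_setP _).1 cE _ _ _ _ a_ge b_ge ab Ex Ey
    |apply: (convex_setP _).1 cS _ _ _ _ a_ge b_ge ab Sx Sy].
have [|||p [hull]] := detV (q @` (E `&` S)) _ _ (ball 0 (of_real d)).
- by move=> _ [x [_ Sx] <-]; exists x.
- move=> n; have [x [Ex cx xg]] := EV n.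
  have Sx : S x by split => //; exact: E1.
  by exists (q x); split; [exists x|case: (gP n) => _ _; exact].
- by apply: nbhsx_ballx; rewrite -(of_real0 R k) ltr_of_real.
have [z [Ez [z1 cz]] <-] := hull (q @` (E `&` S))
  (conj (convex_image _ cES) (@subset_refl _ _)).
rewrite -ball_normE /= sub0r normrN -rnormE ltr_of_real => zd.
have [w wz wd] := quotient_map_lift zd.
have yY : z - w \in Y by apply/(quotient_mapP clY); rewrite wz.
pose y' : subspace_of Y := exist _ (z - w) yY.
have y'E : val y' = z - w by [].
(* The vector [y'] of the subspace may leave the ball by [d]. *)
pose r := (1 + d)^-1.
have r0 : 0 < r by rewrite invr_gt0; lra.
have r1 : 1 - r = d * r by rewrite /r; field; lra.
have rd : r * (1 + d) = 1 by rewrite mulVf //; lra.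
have ny' : rnorm y' <= 1 + d.
  rewrite -[rnorm _]/(rnorm (val y')) y'E; apply: le_trans (ler_rnormD _ _) _.
  by rewrite rnormN; have /unit_ballP := z1; lra.
exists (of_real r *: y'); split.
- apply/unit_ballP; rewrite rnormZ_real ?(ltW r0) // -[leRHS]rd.
  by rewrite ler_pM2l.
- rewrite linearZ_LR (re_of_realM _ (f _)) -Ff y'E raddfB reB.
  have Fw : re (F w) <= d by rewrite (le_trans (re_le_norm _)) // (le_trans (Fle w)) // ltW.
  have c1 : c <= 1.
    apply/ltW/(lt_le_trans cz)/(le_trans (re_le_norm _))/(le_trans (Fle z)).
    exact/unit_ballP.
  have : r * (c - d) < r * (re (F z) - re (F w)) by rewrite ltr_pM2l //; lra.
  have : (1 - r) * (c - d) <= 1 - r by rewrite ger_pMr ?r1 ?mulr_gt0 //; lra.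
  have : d * r <= d by rewrite ger_pMr // -rd ler_pMr //; lra.
  by rewrite -r1; lra.
have sE : v + z = val (s + of_real r *: y') + (of_real (1 - r) *: (z - w) + w).
  rewrite -[val (_ + _)]/(v + of_real r *: (z - w)) -addrA; congr (_ + _).
  by rewrite addrA -scalerDl -of_realD subrKC of_real1 scale1r subrK.
have := Ee z Ez; rewrite sE.
have := ler_rnormD (val (s + of_real r *: y')) (of_real (1 - r) *: (z - w) + w).
have := ler_rnormD (of_real (1 - r) *: (z - w)) w.
have r1' : 0 <= 1 - r by rewrite r1 mulr_ge0 // ltW.
rewrite rnormZ_real // -[rnorm (z - w)]/(rnorm y') -[rnorm (val _)]/(rnorm (s + _)).
have : (1 - r) * rnorm y' <= d.
  by rewrite r1 -mulrA ger_pMr // -rd ler_pM2l.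
rewrite -[rnorm v]/(rnorm s); lra.
Qed.

End SubspaceSlices.

(** * Rank-one operators and slices *)

Section SliceCriterion.
Variables (R : realType) (k : scalar_kind).
Local Notation K := (scalars R k).

(** A generator of the range is rescaled to the norm of [T], which bounds the
    coefficient functional by the norm of [Z]. *)
Lemma rank_one_factor (Z : normedModType K) (T : {linear Z -> Z}) :
  continuous T -> rank_one T -> exists (f : {linear Z -> K^o}) (s : Z),
    [/\ s != 0, rnorm s = opnorm T, forall y, T y = f y *: s &
        forall y, re `|f y| <= rnorm y].
Proof.
move=> cT [z z0 rT].
have [y0 Ty0] : exists y, T y = z.
  have [y _ yz] : range T z by rewrite rT; exists 1 => //; rewrite scale1r.
  by exists y.
have nz := rnorm_gt0 z0.
have T0 : 0 < opnorm T.
  have Ty : 0 < opnorm T * rnorm y0.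
    by apply: lt_le_trans (le_opnorm_linear y0 cT); rewrite Ty0.
  rewrite ltNge; apply/negP => T0.
  by have := mulr_le0_ge0 T0 (rnorm_ge0 y0); rewrite leNgt Ty.
pose s := of_real (opnorm T / rnorm z) *: z.
have ns : rnorm s = opnorm T.
  by rewrite rnormZ_real ?divr_ge0 ?(ltW T0) ?(ltW nz) // divfK // gt_eqF.
have s0 : s != 0.
  by apply: contraTneq T0 => s0; rewrite -ns s0 rnorm0 ltxx.
have /choice[g gE] y : exists a : K, T y = a *: s.
  have [a _ <-] : [set a *: z | a in [set: K]] (T y) by rewrite -rT; exists y.
  exists (a * of_real (rnorm z / opnorm T)); rewrite scalerA -mulrA -of_realM.
  by rewrite mulrA divfK ?gt_eqF // divff ?gt_eqF // of_real1 mulr1.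
have sI (a b : K) : a *: s = b *: s -> a = b.
  move=> /eqP; rewrite -subr_eq0 -scalerBl scaler_eq0 (negPf s0) orbF subr_eq0.
  by move=> /eqP.
have lg : linear (g : Z -> K^o).
  move=> a x y; apply: sI; rewrite -gE linearP !gE scalerDl scalerA; exact: erefl.
pose f : {linear Z -> K^o} :=
  HB.pack (g : Z -> K^o) (GRing.isLinear.Build _ _ _ _ (g : Z -> K^o) lg).
exists f, s; split=> // y.
have := le_opnorm_linear y cT; rewrite gE rnormZ ns mulrC.
by rewrite ler_pM2l.
Qed.

(** The operator [y |-> f y *: s] moves a vector [y] of the slice almost by [s],
    because [f y] is within [r] of [1] as soon as its real part is at least
    [1 - r ^+ 2 / 2]. *)
Lemma daugavet_of_slices (Z : normedModType K) :
  (forall (f : {linear Z -> K^o}) (y0 s : Z) (c e : R),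
    (forall y, re `|f y| <= rnorm y) -> s != 0 -> 0 < c ->
    unit_ball Z y0 -> c < re (f y0) -> 0 < e ->
    exists y, [/\ unit_ball Z y, c - e < re (f y) &
      rnorm s + 1 - e < rnorm (s + y)]) ->
  daugavet_property Z.
Proof.
move=> H T cT rT.
have [M TM] := continuous_linear_ball cT.
have [f [s [s0 ns TE fle]]] := rank_one_factor cT rT.
have nT : 0 < opnorm T by rewrite -ns rnorm_gt0.
have IT y : unit_ball Z y -> rnorm ((idfun \+ T) y) <= 1 + opnorm T.
  move=> y1; apply: le_trans (ler_rnormD _ _) _.
  by apply: lerD (le_opnorm TM y1); exact/unit_ballP.
apply/eqP; rewrite eq_le (opnorm_le IT) /=; apply/ler_addgt0Pr => e e0.
pose r := Num.min 1 (e / (1 + opnorm T)).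
have r0 : 0 < r by rewrite lt_min ltr01 divr_gt0 // addr_gt0.
have r1 : r <= 1 by rewrite ge_min lexx.
have re' : r * (1 + opnorm T) <= e.
  by rewrite -ler_pdivlMr ?addr_gt0 // ge_min lexx orbT.
(* Both the choice of [y0] and that of [y] lose [h], and [norm_sub1_le] allows a
   total loss of [r ^+ 2 / 2]. *)
pose h := r ^+ 2 / 4.
have h0 : 0 < h by rewrite divr_gt0 // exprn_gt0.
have hr : h <= r by rewrite /h; nra.
have [y0 y01 y0T] := opnorm_approx TM (mulr_gt0 nT h0).
have fy0 : 1 - h < re `|f y0|.
  by rewrite -(ltr_pM2l nT) mulrBr mulr1 [ltRHS]mulrC -ns -rnormZ -TE ns.
have [t t1 tf] := unimodular_rotation (f y0).
have ty1 : unit_ball Z (t *: y0).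
  by apply/unit_ballP; rewrite rnormZ_unimodular //; exact/unit_ballP.
have fty : 1 - h < re (f (t *: y0)).
  by have -> : f (t *: y0) = `|f y0| by rewrite linearZ_LR -tf.
have c0 : 0 < 1 - h by rewrite /h; nra.
have [y [y1 fy sy]] := H f _ _ _ _ fle s0 c0 ty1 fty h0.
apply: le_trans (_ : rnorm ((idfun \+ T) y) + e <= _); last first.
  by rewrite lerD2r (le_opnorm IT).
have fy1 : re `|f y - 1| <= r.
  apply: norm_sub1_le (ltW r0) _; last by rewrite /h in fy; lra.
  by apply: le_trans (fle y) _; exact/unit_ballP.
have -> : (idfun \+ T) y = s + y + (f y - 1) *: s.
  by rewrite /= TE scalerBl scale1r (addrC s) addrACA subrr addr0.
have := ler_rnormD (s + y + (f y - 1) *: s) (- ((f y - 1) *: s)).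
rewrite addrK rnormN rnormZ ns; have := ler_wpM2r (ltW nT) fy1; rewrite ns in sy.
by lra.
Qed.

End SliceCriterion.

Theorem theorem6p1 (R : realType) (k : scalar_kind)
    (X : completeNormedModType (scalars R k)) (Y : submodClosed X)
    (clY : closed [set x : X | x \in Y]) :
  daugavet_property X ->
  (forall C : set (quotient_of clY),
    convex_set C -> C `<=` unit_ball (quotient_of clY) -> C 0 -> SCD C 0) ->
  daugavet_property (subspace_of Y).
Proof.
move=> DX SCD0; apply: daugavet_of_slices => f y0 s c e.
exact: (subspace_slice (clY := clY) DX SCD0).
Qed.
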